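(* Let $A$ be a self-adjoint matrix in $M_n(\mathbb{C})$. Then $$\|A\|_{\mathcal{S}^*}=\inf\{\mathrm{Tr}_n(\Delta(\lambda)) : \lambda\in\mathbb{R}^n,\ \text{all }\lambda_j\ge 0,\ -\Delta(\lambda)\le A\le\Delta(\lambda)\}.$$ If $A$ is non zero, then there exists a unique vector $\lambda\in\mathbb{R}^n$ with non negative entries such that $$-\Delta(\lambda)\le A\le \Delta(\lambda)\quad\text{and}\quad \mathrm{Tr}_n(\Delta(\lambda))=\|A\|_{\mathcal{S}^*}.$$
   Context: $\|\cdot\|_\infty$ on $M_n(\mathbb{C})$ is the operator norm. The Schur product is the entrywise product $(X\circ Y)_{(i,j)}=X_{(i,j)}Y_{(i,j)}$, and the Schur multiplier norm is $\|X\|_S=\sup\{\|X\circ Y\|_\infty : Y\in M_n(\mathbb{C}),\ \|Y\|_\infty\le 1\}$. Its dual norm is $\|X\|_{\mathcal{S}^*}=\sup\{|\mathrm{Tr}_n(Y^*X)| : Y\in M_n(\mathbb{C}),\ \|Y\|_S\le 1\}$, where $\mathrm{Tr}_n$ is the (unnormalized) trace. For a vector $\lambda\in\mathbb{C}^n$, $\Delta(\lambda)$ denotes the diagonal $n\times n$ matrix with diagonal entries $\lambda_1,\dots,\lambda_n$. For self-adjoint $C,D$ the relation $C\le D$ means $D-C$ is positive semidefinite. *)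

(* Defs.v *)
From mathcomp Require Import all_boot all_order all_algebra.
From mathcomp Require Import all_classical all_reals complex.

Set Implicit Arguments.
Unset Strict Implicit.
Unset Printing Implicit Defensive.

Import Order.TTheory GRing.Theory Num.Theory.
Local Open Scope ring_scope.
Local Open Scope complex_scope.
Local Open Scope classical_set_scope.
Local Open Scope sesquilinear_scope.

(* The complex numbers are R[i] for R : realType.  Moduli and norms live in R,
   where [sup] and [inf] are available: [normc z : R] satisfies
   `|z| = (normc z)%:C.  The suprema below are over sets that contain 0 and are
   bounded, so the default value of [sup] is never used. *)

Definition vnorm (R : realType) (n : nat) (v : 'cV[R[i]]_n) : R :=
  Num.sqrt (\sum_i Normc.normc (v i 0) ^+ 2).

Definition opnorm (R : realType) (n : nat) (X : 'M[R[i]]_n) : R :=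
  sup [set vnorm (X *m v) | v in [set v : 'cV[R[i]]_n | vnorm v <= 1]].

Definition schur_prod (R : realType) (n : nat) (X Y : 'M[R[i]]_n) :
    'M[R[i]]_n :=
  map2_mx *%R X Y.

Definition schur_norm (R : realType) (n : nat) (X : 'M[R[i]]_n) : R :=
  sup [set opnorm (schur_prod X Y) | Y in [set Y : 'M[R[i]]_n | opnorm Y <= 1]].

Definition schur_dual_norm (R : realType) (n : nat) (X : 'M[R[i]]_n) : R :=
  sup [set Normc.normc (\tr (Y ^t* *m X))
      | Y in [set Y : 'M[R[i]]_n | schur_norm Y <= 1]].

Definition diagC (R : realType) (n : nat) (lambda : 'rV[R]_n) : 'M[R[i]]_n :=
  diag_mx (map_mx (real_complex R) lambda).

(* In the order of R[i], 0 <= z means that z is real and nonnegative. *)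
Definition psdmx (R : realType) (n : nat) (M : 'M[R[i]]_n) : Prop :=
  M \is hermsymmx /\ forall v : 'cV[R[i]]_n, 0 <= (v ^t* *m M *m v) 0 0.

Definition loewner_le (R : realType) (n : nat) (C D : 'M[R[i]]_n) : Prop :=
  psdmx (D - C).

Definition feasible (R : realType) (n : nat) (A : 'M[R[i]]_n)
    (lambda : 'rV[R]_n) : Prop :=
  [/\ forall j, 0 <= lambda 0 j,
      loewner_le (- diagC lambda) A & loewner_le A (diagC lambda)].

(* Main.v *)
Require Import Defs.
From mathcomp Require Import all_boot all_order all_algebra.
From mathcomp Require Import all_classical all_reals complex ring lra.
From mathcomp Require Import topology normedtype derive.

(** The quantity on the right is the value of a semidefinite program, and the
    theorem says that the dual program computes the Schur dual norm.

    Weak duality.  If [D = diagC l] dominates [A] and [-A], then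
    [A = D^(1/2) B D^(1/2)] with [B] a Hermitian contraction, so that
    [\tr (Y^* A)] is a value of the bilinear form of a Schur product of [Y]
    with a contraction at vectors of squared length [\tr D]; this is at most
    [\tr D] when [schur_norm Y <= 1] ([weak_duality]).

    Dual points.  If [P], [Q] are positive semidefinite and [P + Q] has unit
    diagonal, then [Y = P - Q] has Schur norm at most [1]
    ([schur_norm_certificate]), and
    [\tr D - \tr (Y A) = \tr ((D - A) P) + \tr ((D + A) Q)] ([slackE]).
    The semidefinite matrices are written [P = S S^*] and [Q = T T^*].

    No duality gap.  Instead of separating convex sets, one follows the central
    path of an interior point method.  The polynomial function
    [(m - \tr D)^(k+1) \det (D - A) \det (D + A)] has a maximum on the compact
    set of feasible [l] of trace at most [m].  It is positive there, and the
    vanishing of the partial derivatives reads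
    [(D - A)^-1 j j + (D + A)^-1 j j = (k+1) / (m - \tr D)] for all [j].  So
    suitable multiples of the two inverses form a dual point, with a gap
    [2 n (m - \tr D) / (k+1)], which tends to [0] as [k] grows
    ([barrier_certificate], [near_optimal_certificate]).

    Uniqueness is complementary slackness.  At an exact dual optimum, an optimal
    [D] satisfies [(D - A) P = 0] and [(D + A) Q = 0], hence
    [D (P + Q) = A (P - Q)], whose diagonal gives [l j = (A Y) j j]: the dual
    point determines [l].  Since only dual points with an arbitrarily small gap
    are constructed, the argument is carried out with error terms
    ([slack_complementarity], [optimal_unique]). *)

Set Implicit Arguments.
Unset Strict Implicit.
Unset Printing Implicit Defensive.

Import Order.TTheory GRing.Theory Num.Theory.
Import numFieldNormedType.Exports.
Local Open Scope complex_scope.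
Local Open Scope classical_set_scope.
Local Open Scope sesquilinear_scope.
Local Open Scope ring_scope.

Local Notation Re := complex.Re.
Local Notation Im := complex.Im.
Local Notation normc := Normc.normc.

Section SchurDual.
Variable R : realType.
Local Notation C := R[i].
Implicit Types (z w : C) (a : R).

(** * Real parts and moduli of complex numbers *)

Lemma cReD z w : Re (z + w) = Re z + Re w.
Proof. by case: z w => a b []. Qed.

Lemma cReN z : Re (- z) = - Re z.
Proof. by case: z. Qed.

Lemma cReM z w : Re (z * w) = Re z * Re w - Im z * Im w.
Proof. by case: z w => a b []. Qed.

Lemma cReZ a z : Re (a%:C * z) = a * Re z.
Proof. by rewrite cReM mul0r subr0. Qed.

Lemma cRe_sum I (r : seq I) P (F : I -> R[i]) :
  Re (\sum_(i <- r | P i) F i) = \sum_(i <- r | P i) Re (F i).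
Proof. exact: (big_morph _ cReD (erefl _)). Qed.

Lemma cReJ z : Re z^* = Re z.
Proof. by case: z. Qed.

Lemma conj_real a : (a%:C : R[i])^* = a%:C.
Proof. exact: conjc_real. Qed.

Lemma normc_ge0 z : 0 <= normc z.
Proof. by case: z => a b; apply: sqrtr_ge0. Qed.

Lemma normc_conj z : normc z^* = normc z.
Proof. by case: z => a b /=; rewrite sqrrN. Qed.

Lemma normc_real a : normc (a%:C : R[i]) = `|a|.
Proof. by rewrite /= expr0n/= addr0 sqrtr_sqr. Qed.

Lemma normc_sum I (r : seq I) P (F : I -> C) :
  normc (\sum_(i <- r | P i) F i) <= \sum_(i <- r | P i) normc (F i).
Proof.
elim/big_ind2: _ => [|x1 x2 y1 y2 h1 h2|//]; first by rewrite Normc.normc0.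
by apply: le_trans (le_normcD _ _) _; exact: lerD.
Qed.

Lemma Re_le_normc z : Re z <= normc z.
Proof.
case: z => a b /=; apply: le_trans (ler_norm a) _.
by rewrite -sqrtr_sqr ler_wsqrtr // lerDl sqr_ge0.
Qed.

Lemma normc_sqr z : normc z ^+ 2 = Re (z^* * z).
Proof. by case: z => a b /=; rewrite sqr_sqrtr ?addr_ge0 ?sqr_ge0//; ring. Qed.

Lemma mulCJ z : z^* * z = (normc z ^+ 2)%:C.
Proof.
case: z => a b; rewrite [normc _]/= sqr_sqrtr ?addr_ge0 ?sqr_ge0//.
by apply/eqP; rewrite eq_complex /=; apply/andP; split; apply/eqP; ring.
Qed.

(** Multiplying by [c] turns a bound on real parts into a bound on moduli, which
    allows all norms to be described by real-valued forms. *)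
Lemma phase z : exists2 c : R[i], c^* * c = 1 & Re (c * z) = normc z.
Proof.
have [z0|nz0] := eqVneq (normc z) 0.
  exists 1; first by rewrite rmorph1 mulr1.
  by rewrite (Normc.eq0_normc z0) mulr0 Normc.normc0.
exists ((normc z)^-1%:C * z^*).
  rewrite rmorphM/= conjCK conj_real mulrACA [z * _]mulrC mulCJ -!rmorphM/=.
  by rewrite -invfM -expr2 mulVf ?expf_neq0.
by rewrite -mulrA mulCJ -rmorphM/= expr2 mulKf.
Qed.

(** * Complex matrices as a real inner product space *)

Lemma adjointE m n (X : 'M[C]_(m, n)) i j : (X^t*) i j = (X j i)^*.
Proof. by rewrite !mxE. Qed.

Lemma adjointM m n p (X : 'M[C]_(m, n)) (Y : 'M[C]_(n, p)) :
  (X *m Y)^t* = Y^t* *m X^t*.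
Proof. by rewrite trmx_mul map_mxM. Qed.

Lemma adjointK m n (X : 'M[C]_(m, n)) : (X^t*)^t* = X.
Proof. by apply/matrixP=> i j; rewrite !adjointE conjCK. Qed.

Lemma adjointD m n (X Y : 'M[C]_(m, n)) : (X + Y)^t* = X^t* + Y^t*.
Proof. by apply/matrixP=> i j; rewrite !mxE rmorphD. Qed.

Lemma adjointN m n (X : 'M[C]_(m, n)) : (- X)^t* = - X^t*.
Proof. by apply/matrixP=> i j; rewrite !mxE rmorphN. Qed.

Lemma adjointZ m n (c : C) (X : 'M[C]_(m, n)) : (c *: X)^t* = c^* *: X^t*.
Proof. by apply/matrixP=> i j; rewrite !mxE rmorphM. Qed.

Lemma tr_adjoint n (X : 'M[C]_n) : \tr (X^t*) = (\tr X)^*.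
Proof.
by rewrite /mxtrace rmorph_sum; apply: eq_bigr => i _; rewrite adjointE.
Qed.

Lemma det_adjoint n (M : 'M[C]_n) : \det (M^t*) = (\det M)^*.
Proof. by rewrite det_map_mx det_tr. Qed.

Lemma hermP n (X : 'M[C]_n) : reflect (X^t* = X) (X \is hermsymmx).
Proof.
by apply: (iffP (is_hermitianmxP _ _ _)); rewrite /= expr0 scale1r => /esym.
Qed.

(** The real part of the Frobenius inner product, so that order arguments take
    place in [R]. *)
Definition rip m n (X Y : 'M[C]_(m, n)) : R := Re (\tr (X^t* *m Y)).

Lemma ripE m n (X Y : 'M[C]_(m, n)) :
  rip X Y = \sum_i \sum_j Re ((X i j)^* * Y i j).
Proof.
rewrite /rip /mxtrace exchange_big cRe_sum; apply: eq_bigr => j _.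
by rewrite mxE cRe_sum; apply: eq_bigr => i _; rewrite adjointE.
Qed.

Lemma rip_self m n (X : 'M[C]_(m, n)) :
  rip X X = \sum_i \sum_j normc (X i j) ^+ 2.
Proof.
by rewrite ripE; do 2!apply: eq_bigr => ? _; rewrite normc_sqr.
Qed.

Lemma rip_cV n (v : 'cV[C]_n) : rip v v = \sum_i normc (v i 0) ^+ 2.
Proof. by rewrite rip_self; apply: eq_bigr => i _; rewrite big_ord1. Qed.

Lemma rip_ge0 m n (X : 'M[C]_(m, n)) : 0 <= rip X X.
Proof. by rewrite rip_self; do 2!apply: sumr_ge0 => ? _; exact: sqr_ge0. Qed.

Lemma rip_sym m n (X Y : 'M[C]_(m, n)) : rip X Y = rip Y X.
Proof. by rewrite /rip -cReJ -tr_adjoint adjointM adjointK. Qed.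

Lemma ripDr m n (X Y Z : 'M[C]_(m, n)) : rip X (Y + Z) = rip X Y + rip X Z.
Proof. by rewrite /rip mulmxDr mxtraceD cReD. Qed.

Lemma ripNr m n (X Y : 'M[C]_(m, n)) : rip X (- Y) = - rip X Y.
Proof. by rewrite /rip mulmxN raddfN cReN. Qed.

Lemma ripZr m n (a : R) (X Y : 'M[C]_(m, n)) :
  rip X (a%:C *: Y) = a * rip X Y.
Proof. by rewrite /rip -scalemxAr mxtraceZ cReZ. Qed.

Lemma ripDl m n (X Y Z : 'M[C]_(m, n)) : rip (X + Y) Z = rip X Z + rip Y Z.
Proof. by rewrite rip_sym ripDr !(rip_sym Z). Qed.

Lemma ripNl m n (X Y : 'M[C]_(m, n)) : rip (- X) Y = - rip X Y.
Proof. by rewrite rip_sym ripNr (rip_sym Y). Qed.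

Lemma ripZl m n (a : R) (X Y : 'M[C]_(m, n)) :
  rip (a%:C *: X) Y = a * rip X Y.
Proof. by rewrite rip_sym ripZr (rip_sym Y). Qed.

Lemma rip_unimodular m n (c : C) (X : 'M[C]_(m, n)) :
  c^* * c = 1 -> rip (c *: X) (c *: X) = rip X X.
Proof.
by move=> cc; rewrite /rip adjointZ -scalemxAl -scalemxAr scalerA cc scale1r.
Qed.

Lemma rip_mull m n p (M : 'M[C]_(m, n)) (X : 'M[C]_(n, p)) Y :
  rip (M *m X) Y = rip X (M^t* *m Y).
Proof. by rewrite /rip adjointM mulmxA. Qed.

Lemma rip_herm n p (M : 'M[C]_n) (X Y : 'M[C]_(n, p)) : M \is hermsymmx ->
  rip X (M *m Y) = rip Y (M *m X).
Proof. by move=> /hermP hM; rewrite rip_sym rip_mull hM. Qed.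

Lemma rip_sqrD m n (X Y : 'M[C]_(m, n)) :
  rip (X + Y) (X + Y) = rip X X + 2 * rip X Y + rip Y Y.
Proof.
rewrite ripDl (ripDr X) (ripDr Y) (rip_sym Y X).
by move: (rip X X) (rip X Y) (rip Y Y) => a b c; ring.
Qed.

Lemma rip_sqrB m n (X Y : 'M[C]_(m, n)) :
  rip (X - Y) (X - Y) = rip X X - 2 * rip X Y + rip Y Y.
Proof. by rewrite rip_sqrD ripNr ripNl ripNr opprK mulrN. Qed.

Lemma rip_quadD n p (M : 'M[C]_n) (X Y : 'M[C]_(n, p)) : M \is hermsymmx ->
  rip (X + Y) (M *m (X + Y)) =
  rip X (M *m X) + 2 * rip X (M *m Y) + rip Y (M *m Y).
Proof.
move=> hM; rewrite mulmxDr ripDl (ripDr X) (ripDr Y) (rip_herm Y X hM).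
by move: (rip X (M *m X)) (rip X (M *m Y)) (rip Y (M *m Y)) => a b c; ring.
Qed.

Lemma rip_quadN n p (M : 'M[C]_n) (X : 'M[C]_(n, p)) :
  rip (- X) (M *m - X) = rip X (M *m X).
Proof. by rewrite mulmxN ripNl ripNr opprK. Qed.

Lemma rip_quadB n p (M : 'M[C]_n) (X Y : 'M[C]_(n, p)) : M \is hermsymmx ->
  rip (X - Y) (M *m (X - Y)) =
  rip X (M *m X) - 2 * rip X (M *m Y) + rip Y (M *m Y).
Proof.
move=> hM; rewrite (rip_quadD _ _ hM) (rip_quadN M Y) (mulmxN M Y) (ripNr X).
by rewrite mulrN.
Qed.

Lemma rip_mulE n (M : 'M[C]_n) (u v : 'cV[C]_n) :
  rip u (M *m v) = \sum_i \sum_j Re ((u i 0)^* * M i j * v j 0).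
Proof.
rewrite ripE; apply: eq_bigr => i _; rewrite big_ord1 mxE mulr_sumr cRe_sum.
by apply: eq_bigr => j _; rewrite mulrA.
Qed.

Lemma rip_tr n p (M : 'M[C]_n) (S : 'M[C]_(n, p)) :
  rip S (M *m S) = Re (\tr (M *m (S *m S^t*))).
Proof. by rewrite /rip mxtrace_mulC !mulmxA. Qed.

Lemma rip_delta n (X : 'M[C]_n) i j (c : C) :
  rip (c *: delta_mx i 0 : 'cV_n) (X *m delta_mx j 0) = Re (c^* * X i j).
Proof.
rewrite -colE ripE (bigD1 i)//= big_ord1 !mxE !eqxx mulr1 big1 ?addr0// => k ki.
by rewrite big_ord1 !mxE (negbTE ki)/= mulr0 rmorph0 mul0r.
Qed.

Lemma rip_delta_self n (i : 'I_n) :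
  rip (delta_mx i 0 : 'cV[C]_n) (delta_mx i 0) = 1.
Proof.
have := rip_delta 1%:M i i 1.
by rewrite scale1r mul1mx rmorph1 mul1r mxE eqxx.
Qed.

Lemma col_mulmx m n p (M : 'M[C]_(m, n)) (X : 'M[C]_(n, p)) j :
  col j (M *m X) = M *m col j X.
Proof. by rewrite !colE mulmxA. Qed.

Lemma rip_cols m n (X Y : 'M[C]_(m, n)) :
  rip X Y = \sum_j rip (col j X) (col j Y).
Proof.
rewrite ripE exchange_big; apply: eq_bigr => j _; rewrite ripE.
by apply: eq_bigr => i _; rewrite big_ord1 !mxE.
Qed.

(** Positivity on vectors passes to matrices because the form is the sum of its
    values on columns. *)
Lemma rip_psd n p (M : 'M[C]_n) (X : 'M[C]_(n, p)) :
  psdmx M -> 0 <= rip X (M *m X).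
Proof.
case=> _ h; rewrite rip_cols; apply: sumr_ge0 => j _.
have := h (col j X); rewrite lecE => /andP[_].
by rewrite col_mulmx /rip /mxtrace big_ord1 mulmxA.
Qed.

Lemma psdP n (M : 'M[C]_n) : M \is hermsymmx ->
  (forall v : 'cV[C]_n, 0 <= rip v (M *m v)) -> psdmx M.
Proof.
move=> hM h; split=> // v; rewrite lecE.
have := h v; rewrite /rip /mxtrace big_ord1 mulmxA => -> /=; rewrite andbT.
have : ((v^t* *m M *m v) 0 0)^* = (v^t* *m M *m v) 0 0.
  by rewrite -adjointE !adjointM adjointK (hermP _ hM) mulmxA.
case: (_ 0 0) => a b [] /= hb; apply/eqP; lra.
Qed.

(** * Operator norm and Schur norm *)

Lemma vnormE n (v : 'cV[C]_n) : vnorm v = Num.sqrt (rip v v).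
Proof. by rewrite rip_cV. Qed.

Lemma vnorm_ge0 n (v : 'cV[C]_n) : 0 <= vnorm v.
Proof. exact: sqrtr_ge0. Qed.

Lemma vnorm_sqr n (v : 'cV[C]_n) : vnorm v ^+ 2 = rip v v.
Proof. by rewrite vnormE sqr_sqrtr ?rip_ge0. Qed.

Lemma vnorm_le1 n (v : 'cV[C]_n) : (vnorm v <= 1) = (rip v v <= 1).
Proof. by rewrite vnormE -[X in _ <= X]sqrtr1 ler_sqrt. Qed.

Lemma vnorm0 n : vnorm (0 : 'cV[C]_n) = 0.
Proof. by rewrite vnormE /rip mulmx0 mxtrace0 sqrtr0. Qed.

Lemma vnormZ n (a : R) (v : 'cV[C]_n) : 0 <= a ->
  vnorm (a%:C *: v) = a * vnorm v.
Proof.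
move=> a0; rewrite !vnormE ripZl ripZr mulrA sqrtrM ?mulr_ge0//.
by rewrite -expr2 sqrtr_sqr ger0_norm.
Qed.

Lemma vnorm_eq0 n (v : 'cV[C]_n) : vnorm v = 0 -> v = 0.
Proof.
move=> v0; have := vnorm_sqr v; rewrite v0 expr0n/= rip_cV => /esym/eqP.
rewrite psumr_eq0; last by move=> i _; exact: sqr_ge0.
move=> /allP h; apply/matrixP=> i j; rewrite ord1 mxE.
have := h i (mem_index_enum i); rewrite /= sqrf_eq0 => /eqP.
exact: Normc.eq0_normc.
Qed.

Lemma coord_le_vnorm n (v : 'cV[C]_n) i : normc (v i 0) <= vnorm v.
Proof.
rewrite -(@ler_pXn2r _ 2)// ?nnegrE ?normc_ge0 ?vnorm_ge0//.
rewrite vnorm_sqr rip_cV (bigD1 i)//= lerDl.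
by apply: sumr_ge0 => j _; exact: sqr_ge0.
Qed.

(** A crude bound for the square of the operator norm.  It is monotone in the
    moduli of the entries, hence uniform over the Schur products of [X] with
    contractions: this is what makes the suprema in the definitions finite. *)
Definition entry_bound n (X : 'M[C]_n) : R :=
  \sum_i (\sum_j normc (X i j)) ^+ 2.

Lemma entry_bound_ge0 n (X : 'M[C]_n) : 0 <= entry_bound X.
Proof. by apply: sumr_ge0 => i _; exact: sqr_ge0. Qed.

Lemma rip_mulmx_le n (X Z : 'M[C]_n) (v : 'cV[C]_n) :
  (forall i j, normc (Z i j) <= normc (X i j)) ->
  rip (Z *m v) (Z *m v) <= entry_bound X * rip v v.
Proof.
move=> ZX; rewrite rip_cV mulr_suml; apply: ler_sum => i _.
rewrite -vnorm_sqr -exprMn ler_pXn2r// ?nnegrE ?normc_ge0//; last first.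
  by rewrite mulr_ge0 ?vnorm_ge0// sumr_ge0// => j _; exact: normc_ge0.
rewrite mxE; apply: le_trans (normc_sum _ _ _) _.
rewrite mulr_suml; apply: ler_sum => j _; rewrite Normc.normcM.
by apply: ler_pM; rewrite ?normc_ge0 ?coord_le_vnorm.
Qed.

Lemma rip_mulmx_bounded n (X : 'M[C]_n) (v : 'cV[C]_n) :
  rip (X *m v) (X *m v) <= entry_bound X * rip v v.
Proof. exact: rip_mulmx_le. Qed.

Lemma vnorm_mulmx_le n (X Z : 'M[C]_n) (v : 'cV[C]_n) :
  (forall i j, normc (Z i j) <= normc (X i j)) -> vnorm v <= 1 ->
  vnorm (Z *m v) <= Num.sqrt (entry_bound X).
Proof.
move=> ZX; rewrite vnorm_le1 => v1; rewrite vnormE ler_wsqrtr//.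
apply: le_trans (rip_mulmx_le v ZX) _.
by rewrite ler_piMr ?entry_bound_ge0.
Qed.

Lemma opnorm_le n (X : 'M[C]_n) (c : R) :
  (forall v, vnorm v <= 1 -> vnorm (X *m v) <= c) -> opnorm X <= c.
Proof.
move=> h; apply: ge_sup; last by move=> _ [v v1 <-]; exact: h.
by exists (vnorm (X *m 0)); exists 0; rewrite //= vnorm0 ler01.
Qed.

Lemma vnorm_le_opnorm n (X : 'M[C]_n) v :
  vnorm v <= 1 -> vnorm (X *m v) <= opnorm X.
Proof.
move=> v1; apply: ub_le_sup; last by exists v.
exists (Num.sqrt (entry_bound X)) => _ [w w1 <-].
exact: vnorm_mulmx_le.
Qed.

(** The operator norm is at most [1], in a form linear in [X] and without
    supremum or square root. *)
Definition contraction n (X : 'M[C]_n) : Prop :=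
  forall u v : 'cV[C]_n, 2 * rip u (X *m v) <= rip u u + rip v v.

(** Taking [u = X v] in the bilinear inequality gives back the norm inequality;
    conversely expand [0 <= |u - X v|^2]. *)
Lemma opnorm_le1P n (X : 'M[C]_n) : opnorm X <= 1 <-> contraction X.
Proof.
split=> [X1 u v|cX].
  suff Xv : rip (X *m v) (X *m v) <= rip v v.
    have := rip_ge0 (u - X *m v).
    rewrite rip_sqrB; move: Xv.
    move: (rip u u) (rip v v) (rip u (X *m v)) (rip (X *m v) (X *m v)).
    by move=> a b c d; lra.
  have [v0|nv0] := eqVneq (vnorm v) 0.
    by rewrite (vnorm_eq0 v0) mulmx0.
  have vgt0 : 0 < vnorm v by rewrite lt_def nv0 vnorm_ge0.
  have : vnorm (X *m ((vnorm v)^-1%:C *: v)) <= 1.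
    apply: le_trans X1; apply: vnorm_le_opnorm.
    by rewrite vnormZ ?invr_ge0 ?vnorm_ge0// mulVf.
  rewrite -scalemxAr vnormZ ?invr_ge0 ?vnorm_ge0// ler_pdivrMl// mulr1.
  by rewrite -!vnorm_sqr ler_pXn2r// nnegrE vnorm_ge0.
apply: opnorm_le => v; rewrite !vnorm_le1 => v1.
by have := cX (X *m v) v; lra.
Qed.

Lemma contraction0 n : contraction (0 : 'M[C]_n).
Proof.
move=> u v; rewrite mul0mx {1}/rip mulmx0 mxtrace0 mulr0.
by rewrite addr_ge0 ?rip_ge0.
Qed.

(** Test on two basis vectors, one of them rotated by the phase of the entry. *)
Lemma contraction_entry n (X : 'M[C]_n) i j :
  contraction X -> normc (X i j) <= 1.
Proof.
move=> cX; have [c cc <-] := phase (X i j).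
have := cX (c^* *: delta_mx i 0) (delta_mx j 0).
rewrite rip_delta conjCK rip_unimodular ?conjCK 1?mulrC// !rip_delta_self; lra.
Qed.

Lemma contraction_mx n p (X : 'M[C]_n) (U V : 'M[C]_(n, p)) : contraction X ->
  2 * rip U (X *m V) <= rip U U + rip V V.
Proof.
move=> cX; rewrite 3!rip_cols mulr_sumr -big_split; apply: ler_sum => j _.
by rewrite col_mulmx.
Qed.

(** Polarisation: [4 rip u (B v)] is the difference of the values of the
    quadratic form at [u + v] and [u - v], and the parallelogram law sums the
    bounds for these values. *)
Lemma herm_contraction n (B : 'M[C]_n) : B \is hermsymmx ->
  (forall v : 'cV[C]_n, `|rip v (B *m v)| <= rip v v) -> contraction B.
Proof.
move=> hB h u v.
have /ler_normlP[_] := h (u + v); have /ler_normlP[+ _] := h (u - v).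
rewrite (rip_quadB _ _ hB) (rip_quadD _ _ hB) rip_sqrB rip_sqrD.
move: (rip u u) (rip v v) (rip u v) => a b c.
move: (rip u (B *m u)) (rip v (B *m v)) (rip u (B *m v)) => d e f.
lra.
Qed.

(** The supremum behaves as expected because the entries of a contraction have
    modulus at most [1], so that [entry_bound Y] controls all Schur products. *)
Lemma schur_norm_le1P n (Y : 'M[C]_n) : schur_norm Y <= 1 <->
  forall X, contraction X -> contraction (schur_prod Y X).
Proof.
split=> [Y1 X cX|h].
  apply/opnorm_le1P; apply: le_trans Y1; apply: ub_le_sup; last first.
    by exists X => //; exact/opnorm_le1P.
  exists (Num.sqrt (entry_bound Y)) => _ [Z /opnorm_le1P cZ <-].
  apply: opnorm_le => v; apply: vnorm_mulmx_le => i j.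
  by rewrite mxE Normc.normcM ler_piMr ?normc_ge0 ?contraction_entry.
apply: ge_sup; last by move=> _ [X /opnorm_le1P /h /opnorm_le1P ? <-].
exists (opnorm (schur_prod Y 0)); exists 0 => //.
exact/opnorm_le1P/contraction0.
Qed.

(** * Feasible vectors and weak duality *)

Lemma diagC_herm n (l : 'rV[R]_n) : diagC l \is hermsymmx.
Proof.
apply/hermP/matrixP => i j; rewrite adjointE !mxE eq_sym rmorphMn/= conj_real.
by case: eqP => [->|].
Qed.

Lemma tr_diagC n (l : 'rV[R]_n) : \tr (diagC l) = (\sum_j l 0 j)%:C.
Proof.
by rewrite mxtrace_diag rmorph_sum; apply: eq_bigr => j _; rewrite mxE.
Qed.

Lemma rip_diagC n p (l : 'rV[R]_n) (U V : 'M[C]_(n, p)) :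
  rip U (diagC l *m V) = \sum_i l 0 i * \sum_j Re ((U i j)^* * V i j).
Proof.
rewrite ripE; apply: eq_bigr => i _; rewrite mulr_sumr.
by apply: eq_bigr => j _; rewrite mul_diag_mx !mxE mulrCA cReZ.
Qed.

(** The two operator inequalities are one bound on the quadratic form of [A];
    the signs of the entries of [l] follow by testing on basis vectors. *)
Lemma feasibleP n (A : 'M[C]_n) (l : 'rV[R]_n) : A \is hermsymmx ->
  feasible A l <-> forall v : 'cV[C]_n, `|rip v (A *m v)| <= rip v (diagC l *m v).
Proof.
move=> hA.
have quadD (M N : 'M[C]_n) (v : 'cV[C]_n) :
    rip v ((M + N) *m v) = rip v (M *m v) + rip v (N *m v).
  by rewrite mulmxDl ripDr.
have quadB (M N : 'M[C]_n) (v : 'cV[C]_n) :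
    rip v ((M - N) *m v) = rip v (M *m v) - rip v (N *m v).
  by rewrite quadD mulNmx ripNr.
split=> [[_ hm hp] v|h].
  have := rip_psd v hm; have := rip_psd v hp.
  rewrite opprK (quadD A) (quadB _ A) ler_norml.
  by move: (rip v _) (rip v (A *m v)) => a b; lra.
have hD := diagC_herm l.
have herm (M N : 'M[C]_n) : M \is hermsymmx -> N \is hermsymmx ->
    M - N \is hermsymmx.
  by move=> /hermP hM /hermP hN; apply/hermP; rewrite adjointD adjointN hM hN.
have hND : - diagC l \is hermsymmx by apply/hermP; rewrite adjointN (hermP _ hD).
split.
- move=> j; have := le_trans (normr_ge0 _) (h (delta_mx j 0)).
  have := rip_delta (diagC l) j j 1.
  by rewrite scale1r => ->; rewrite rmorph1 mul1r !mxE eqxx mulr1n.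
- apply: psdP => [|v]; first exact: herm.
  have := h v; rewrite opprK quadD ler_norml.
  by move: (rip v (A *m v)) (rip v _) => a b; lra.
- apply: psdP => [|v]; first exact: herm.
  have := h v; rewrite quadB ler_norml.
  by move: (rip v (A *m v)) (rip v _) => a b; lra.
Qed.

Lemma feasible_psd n (A : 'M[C]_n) l : feasible A l ->
  psdmx (diagC l - A) /\ psdmx (diagC l + A).
Proof. case=> _ h1 h2; split; first exact: h2.
by rewrite addrC -[diagC l]opprK; exact: h1. Qed.

(** The form of the Schur product of [Y] with [conj A i j / (d i * d j)],
    evaluated at [d = sqrt l] on both sides, is the conjugate of
    [\tr (Y^* A)]. *)
Lemma weak_duality_pos n (A Y : 'M[C]_n) (l : 'rV[R]_n) : A \is hermsymmx ->
  schur_norm Y <= 1 -> (forall j, 0 < l 0 j) ->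
  (forall v : 'cV[C]_n, `|rip v (A *m v)| <= rip v (diagC l *m v)) ->
  normc (\tr (Y^t* *m A)) <= \sum_j l 0 j.
Proof.
move=> hA /schur_norm_le1P Y1 l0 hl.
pose d i := Num.sqrt (l 0 i).
have d0 i : d i != 0 by rewrite gt_eqF// sqrtr_gt0.
have dC0 i : (d i)%:C != 0 :> C by rewrite (fmorph_eq0 (real_complex R)).
have dd i : d i ^+ 2 = l 0 i by rewrite sqr_sqrtr// ltW.
pose B : 'M[C]_n := \matrix_(i, j) ((A i j)^* / ((d i)%:C * (d j)%:C)).
have cB : contraction B.
  apply: herm_contraction => [|v].
    apply/hermP/matrixP => i j.
    rewrite adjointE !mxE rmorphM/= conjCK fmorphV/= rmorphM/= !conj_real.
    by rewrite -(adjointE A) (hermP _ hA) [(d j)%:C * _]mulrC.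
  (* conjugating [v] undoes the conjugation of the entries of [A] *)
  pose w : 'cV[C]_n := \col_i ((v i 0)^* / (d i)%:C).
  have -> : rip v (B *m v) = rip w (A *m w).
    rewrite !rip_mulE; apply: eq_bigr => i _; apply: eq_bigr => j _.
    rewrite -cReJ !mxE !(rmorphM, fmorphV)/= !conjCK !conj_real.
    by congr Re; rewrite invfM; ring.
  apply: le_trans (hl w) _; rewrite rip_diagC rip_cV; apply: ler_sum => i _.
  rewrite big_ord1 -normc_sqr mxE Normc.normcM normc_conj Normc.normcV.
  by rewrite normc_real exprMn exprVn real_normK ?num_real// dd mulrC divfK// -dd
    ?expf_neq0.
have [c cc <-] := phase (\tr (Y^t* *m A)).
pose e : 'cV[C]_n := \col_i (d i)%:C.
have := Y1 _ cB (c *: e) e; rewrite rip_unimodular//.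
have -> : rip e e = \sum_j l 0 j.
  by rewrite rip_cV; apply: eq_bigr => i _; rewrite mxE normc_real real_normK
    ?num_real.
suff -> : rip (c *: e) (schur_prod Y B *m e) = Re (c * \tr (Y^t* *m A)) by lra.
rewrite rip_mulE /mxtrace mulr_sumr cRe_sum exchange_big; apply: eq_bigr => j _.
rewrite [(_ *m _) j j]mxE mulr_sumr cRe_sum; apply: eq_bigr => i _.
rewrite -cReJ !mxE !(rmorphM, fmorphV)/= !conjCK !conj_real.
by congr Re; field; rewrite !dC0.
Qed.

(** Entries of [l] may vanish, so [l] is shifted by a small constant before
    dividing by its square root. *)
Lemma weak_duality n (A Y : 'M[C]_n) (l : 'rV[R]_n) : A \is hermsymmx ->
  schur_norm Y <= 1 -> feasible A l ->
  normc (\tr (Y^t* *m A)) <= \sum_j l 0 j.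
Proof.
move=> hA Y1 fl; have [l0 _ _] := fl; have /feasibleP-/(_ hA) hl := fl.
apply/ler_addgt0Pr => e e0.
(* [n.+1] rather than [n], to avoid dividing by zero in dimension [0] *)
pose a := e / n.+1%:R.
have a0 : 0 < a by rewrite divr_gt0.
apply: (@le_trans _ _ (\sum_j (l + const_mx a) 0 j)).
  apply: (weak_duality_pos hA Y1) => [j|v]; first by rewrite !mxE ltr_wpDl.
  apply: le_trans (hl v) _; rewrite !rip_diagC; apply: ler_sum => i _.
  rewrite big_ord1 -normc_sqr; apply: ler_wpM2r; first exact: sqr_ge0.
  by rewrite !mxE lerDl ltW.
under eq_bigr do rewrite !mxE; rewrite big_split/= lerD2l sumr_const card_ord.
by rewrite -mulr_natr /a mulrAC ler_pdivrMr// ler_wpM2l ?ler_nat ?ltW.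
Qed.

(** * Dual points *)

Lemma gram_diag n (S : 'M[C]_n) i :
  (S *m S^t*) i i = (\sum_k normc (S i k) ^+ 2)%:C.
Proof.
by rewrite mxE rmorph_sum; apply: eq_bigr => k _; rewrite adjointE mulrC mulCJ.
Qed.

Definition unit_diag n (S T : 'M[C]_n) : Prop :=
  forall j, Re ((S *m S^t* + T *m T^t*) j j) = 1.

(** Writing [P = \sum_k s_k s_k^*] over the columns [s_k] of [S] (and likewise
    for [T]), the form of [P] Schur [X] at [u], [v] is a sum of forms of [X] at
    the vectors [u] and [v] multiplied entrywise by [conj s_k].  Their squared
    lengths add up to those of [u] and [v] since the diagonal of
    [S S^* + T T^*] is [1]. *)
Lemma schur_norm_certificate n (S T : 'M[C]_n) :
  unit_diag S T ->
  schur_norm (S *m S^t* - T *m T^t*) <= 1.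
Proof.
move=> hd; apply/schur_norm_le1P => X cX u v.
(* the columns of [W Z x] are the entrywise products of [x] with the conjugate
   columns of [Z] *)
pose W (Z : 'M[C]_n) (x : 'cV[C]_n) : 'M[C]_n :=
  \matrix_(i, k) (x i 0 * (Z i k)^*).
have key (Z : 'M[C]_n) : rip (W Z u) (X *m W Z v) =
    rip u (schur_prod (Z *m Z^t*) X *m v).
  rewrite ripE rip_mulE; apply: eq_bigr => i _.
  rewrite -cRe_sum -[RHS]cRe_sum; congr Re.
  under eq_bigr do rewrite [(X *m _) i _]mxE mulr_sumr.
  rewrite exchange_big; apply: eq_bigr => j _.
  rewrite !mxE !mulr_suml mulr_sumr mulr_suml; apply: eq_bigr => k _.
  by rewrite !mxE rmorphM/= conjCK; ring.
have split : schur_prod (S *m S^t* - T *m T^t*) X =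
    schur_prod (S *m S^t*) X - schur_prod (T *m T^t*) X.
  by apply/matrixP => i j; rewrite !mxE mulrBl.
have sq x : rip (W S x) (W S x) + rip (W T x) (W T x) = rip x x.
  rewrite !rip_self -big_split; apply: eq_bigr => i _; rewrite big_ord1/=.
  have sqW (Z : 'M[C]_n) : \sum_k normc (W Z x i k) ^+ 2 =
      normc (x i 0) ^+ 2 * \sum_k normc (Z i k) ^+ 2.
    rewrite mulr_sumr; apply: eq_bigr => k _.
    by rewrite mxE Normc.normcM normc_conj exprMn.
  have := hd i; rewrite mxE cReD !gram_diag/= => hi.
  by rewrite !sqW -mulrDr hi mulr1.
have := contraction_mx (W S u) (W S v) cX.
(* the minus sign of [T T^*] is absorbed into the left argument *)
have := contraction_mx (- W T u) (W T v) cX.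
rewrite (ripNl (W T u)) (ripNr (- W T u)) (ripNl (W T u) (W T u)) opprK.
rewrite -(sq u) -(sq v) split mulmxBl ripDr ripNr -(key S) -(key T).
move: (rip (W S u) (X *m W S v)) (rip (W T u) (X *m W T v)) => a b.
move: (rip (W S u) (W S u)) (rip (W S v) (W S v)) => c d.
by move: (rip (W T u) (W T u)) (rip (W T v) (W T v)) => e f; lra.
Qed.

(** The duality gap between [l] and the dual point [S S^* - T T^*], as [slackE]
    shows; this form makes it visibly nonnegative for feasible [l]. *)
Definition slack n (A : 'M[C]_n) (l : 'rV[R]_n) (S T : 'M[C]_n) : R :=
  rip S ((diagC l - A) *m S) + rip T ((diagC l + A) *m T).

Lemma rip_diag_gram n (l : 'rV[R]_n) (S : 'M[C]_n) :
  rip S (diagC l *m S) = \sum_i l 0 i * Re ((S *m S^t*) i i).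
Proof.
rewrite rip_diagC; apply: eq_bigr => i _; rewrite gram_diag/=; congr (_ * _).
by apply: eq_bigr => k _; rewrite -normc_sqr.
Qed.

Lemma slackE n (A : 'M[C]_n) l S T : unit_diag S T ->
  slack A l S T = \sum_j l 0 j - Re (\tr ((S *m S^t* - T *m T^t*) *m A)).
Proof.
move=> uST; rewrite mxtrace_mulC mulmxBr raddfB/= cReD cReN -!rip_tr /slack.
rewrite mulmxBl mulmxDl !ripDr ripNr !rip_diag_gram.
suff -> : \sum_j l 0 j = \sum_j l 0 j * Re ((S *m S^t*) j j) +
  \sum_j l 0 j * Re ((T *m T^t*) j j) by lra.
rewrite -big_split; apply: eq_bigr => j _ /=.
by rewrite -mulrDr -cReD; have := uST j; rewrite mxE => ->; rewrite mulr1.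
Qed.

(** * Complementary slackness *)

Lemma psd_diag_ge0 n (M : 'M[C]_n) j : psdmx M -> 0 <= Re (M j j).
Proof.
move=> /(rip_psd (delta_mx j 0 : 'cV_n)); have := rip_delta M j j 1.
by rewrite scale1r rmorph1 mul1r => ->.
Qed.

(** Cauchy-Schwarz for the semidefinite form of [M], applied to [S] and to the
    matrix that keeps only row [j] of [S]; [e] is the weight in the inequality
    between the arithmetic and geometric means. *)
Lemma row_slack n (M S : 'M[C]_n) (e : R) j : psdmx M ->
  2 * e * `|Re ((M *m (S *m S^t*)) j j)| <=
  e ^+ 2 * (Re (M j j) * Re ((S *m S^t*) j j)) + rip S (M *m S).
Proof.
move=> pM; have [hM _] := pM; set G := S *m S^t*.
have trE (N : 'M[C]_n) : \tr (delta_mx j j *m N) = N j j.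
  rewrite /mxtrace (bigD1 j)//= big1 ?addr0 => [|i ij].
    rewrite mxE (bigD1 j)//= big1 ?addr0 => [|k kj]; rewrite !mxE ?eqxx ?mul1r//.
    by rewrite (negbTE kj) andbF mul0r.
  by rewrite mxE big1// => k _; rewrite !mxE (negbTE ij) mul0r.
pose X := delta_mx j j *m S.
have E0 : (delta_mx j j : 'M[C]_n)^t* = delta_mx j j.
  by rewrite trmx_delta map_delta_mx.
have XMS : rip X (M *m S) = Re ((M *m G) j j).
  by rewrite rip_mull E0 /rip mxtrace_mulC -!mulmxA trE.
have XMX : rip X (M *m X) = Re (M j j) * Re (G j j).
  rewrite rip_mull E0 /rip mxtrace_mulC -!mulmxA trE -/G.
  rewrite mxE (bigD1 j)//= big1 ?addr0 => [|k kj]; last first.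
    rewrite mxE big1 ?mulr0// => i _; rewrite mxE (negbTE kj) mul0r//.
  rewrite mxE (bigD1 j)//= big1 ?addr0 => [|i ij]; last first.
    by rewrite mxE (negbTE ij) andbF mul0r.
  by rewrite [delta_mx _ _ _ _]mxE !eqxx mul1r gram_diag mulrC cReZ mulrC.
have := rip_psd (e%:C *: X + S) pM; have := rip_psd (e%:C *: X - S) pM.
rewrite (rip_quadB _ _ hM) (rip_quadD _ _ hM) -(scalemxAr e%:C M X).
rewrite (ripZl e X (e%:C *: _)) (ripZr e X) (ripZl e X (M *m S)) XMS XMX.
move: (Re ((M *m G) j j)) (rip S (M *m S)) (Re (M j j) * Re (G j j)) => a b c.
by case: (ler0P a) => _; lra.
Qed.

(** Adding the two instances of [row_slack]: as [s + t = 1], the weighted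
    diagonal entries [x * s + y * t] are at most [x + y]. *)
Lemma complementarity_arith (a b x y s t p q e m : R) :
  0 <= x -> 0 <= y -> 0 <= s -> 0 <= t -> s + t = 1 -> x + y = 2 * m -> 0 < e ->
  2 * e * `|a| <= e ^+ 2 * (x * s) + p -> 2 * e * `|b| <= e ^+ 2 * (y * t) + q ->
  p + q <= e ^+ 2 -> `|a + b| <= e * (m + 1).
Proof.
move=> x0 y0 s0 t0 st xy e0 ha hb pq; apply: le_trans (ler_normD _ _) _.
rewrite -(@ler_pM2l _ (2 * e)) ?mulr_gt0// mulrDr.
have xs : x * s <= x by rewrite ler_piMr//; lra.
have yt : y * t <= y by rewrite ler_piMr//; lra.
have e2 : 0 <= e ^+ 2 := sqr_ge0 e.
have := ler_wpM2l e2 xs; have := ler_wpM2l e2 yt.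
have : 2 * e * (e * (m + 1)) = e ^+ 2 * x + e ^+ 2 * y + 2 * e ^+ 2.
  by rewrite -[X in X + 2 * _]mulrDr xy; ring.
lra.
Qed.

(** By the normalisation of the diagonal, the difference on the left is the real
    part of a diagonal entry of [(D - A) S S^* + (D + A) T T^*].  The number
    that approximates [l 0 j] does not depend on [l]: this is the source of
    uniqueness. *)
Lemma slack_complementarity n (A : 'M[C]_n) l S T (e : R) j :
  feasible A l -> unit_diag S T -> 0 < e -> slack A l S T <= e ^+ 2 ->
  `|l 0 j - Re ((A *m (S *m S^t* - T *m T^t*)) j j)| <= e * (l 0 j + 1).
Proof.
move=> fl uST e0; have [l0 _ _] := fl; have [p1 p2] := feasible_psd fl.
have d1 := psd_diag_ge0 j p1; have d2 := psd_diag_ge0 j p2.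
have := row_slack S e j p1; have := row_slack T e j p2.
have H : Re ((diagC l - A) j j) + Re ((diagC l + A) j j) = 2 * l 0 j.
  by rewrite !mxE eqxx mulr1n !cReD cReN/=; lra.
have g1 : 0 <= Re ((S *m S^t*) j j).
  by rewrite gram_diag/= sumr_ge0// => k _; exact: sqr_ge0.
have g2 : 0 <= Re ((T *m T^t*) j j).
  by rewrite gram_diag/= sumr_ge0// => k _; exact: sqr_ge0.
have uj := uST j; rewrite mxE cReD in uj.
have diagE (G : 'M[C]_n) : Re ((diagC l *m G) j j) = l 0 j * Re (G j j).
  by rewrite mul_diag_mx !mxE cReZ.
have -> : l 0 j - Re ((A *m (S *m S^t* - T *m T^t*)) j j) =
    Re (((diagC l - A) *m (S *m S^t*)) j j) +
    Re (((diagC l + A) *m (T *m T^t*)) j j).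
  have addE (M N : 'M[C]_n) : Re ((M + N) j j) = Re (M j j) + Re (N j j).
    by rewrite mxE cReD.
  have subE (M N : 'M[C]_n) : Re ((M - N) j j) = Re (M j j) - Re (N j j).
    by rewrite !mxE cReD cReN.
  rewrite mulmxBr (subE (A *m _)) mulmxBl (subE (diagC l *m _)) mulmxDl.
  rewrite (addE (diagC l *m _)) !diagE.
  have : l 0 j * Re ((S *m S^t*) j j) + l 0 j * Re ((T *m T^t*) j j) = l 0 j.
    by rewrite -mulrDr uj mulr1.
  move: (l 0 j * _) (l 0 j * _) (Re ((A *m _) j j)) (Re ((A *m _) j j)).
  by move=> c d a b <-; ring.
by move=> hT hS hs; exact: complementarity_arith d1 d2 g1 g2 uj H e0 hS hT hs.
Qed.

(** * Positive semidefinite and positive definite matrices *)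

(** Spectral theorem: scale the columns of the unitary by the square roots of
    the eigenvalues. *)
Lemma psd_gram n (M : 'M[C]_n) : psdmx M -> exists S : 'M[C]_n, M = S *m S^t*.
Proof.
move=> [hM pM].
have /orthomx_spectralP := hermitian_normalmx hM.
have uP := spectral_unitarymx M; set P := spectralmx M in uP *.
set d := spectral_diag M; rewrite (invmx_unitary uP) => ME.
have PP : P *m P^t* = 1%:M by apply/unitarymxP.
have d0 i : 0 <= d 0 i.
  have := pM (P^t* *m delta_mx i 0); rewrite adjointM adjointK ME !mulmxA.
  rewrite -(mulmxA _ P (P^t*)) PP mulmx1 -(mulmxA _ P (P^t*)) PP mulmx1.
  have -> : ((delta_mx i 0 : 'cV[C]_n)^t*) = delta_mx 0 i.
    by rewrite trmx_delta map_delta_mx.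
  by rewrite -rowE -colE !mxE eqxx mulr1n.
exists (P^t* *m diag_mx (\row_i sqrtC (d 0 i))).
rewrite {1}ME adjointM adjointK [RHS]mulmxA; congr (_ *m P).
rewrite -mulmxA; congr (P^t* *m _).
apply/matrixP => i j; rewrite mul_diag_mx !mxE eq_sym.
case: eqP => [->|_]; last by rewrite rmorph0 mulr0.
by rewrite !mulr1n geC0_conj ?sqrtC_ge0// -expr2 sqrtCK.
Qed.

Lemma psd_det n (M : 'M[C]_n) : psdmx M -> 0 <= \det M.
Proof.
by move=> /psd_gram [S ->]; rewrite det_mulmx det_adjoint mul_conjC_ge0.
Qed.

Lemma psd_det_gt0 n (M : 'M[C]_n) : psdmx M -> M \in unitmx -> 0 < Re (\det M).
Proof.
move=> /psd_det; rewrite unitmxE unitfE lecE => /andP[/eqP iM rM] dM.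
rewrite lt_def rM andbT; apply: contra dM => /eqP r0.
by rewrite eq_complex r0 iM !eqxx.
Qed.

Lemma psd_inv n (M : 'M[C]_n) : psdmx M -> M \in unitmx -> psdmx (invmx M).
Proof.
move=> pM uM; have [/hermP hM _] := pM; apply: psdP => [|v].
  by apply/hermP; rewrite trmx_inv map_invmx hM.
have := rip_psd (invmx M *m v) pM.
by rewrite mulKVmx// rip_sym.
Qed.

(** The factors [S] and [T] of a dual point come from here, with [a] the scaling
    that normalises the diagonal. *)
Lemma inv_gram n (M : 'M[C]_n) (a : R) : psdmx M -> M \in unitmx -> 0 <= a ->
  exists S : 'M[C]_n, S *m S^t* = a%:C *: invmx M.
Proof.
move=> pM uM a0; have [S ES] := psd_gram (psd_inv pM uM).
exists ((Num.sqrt a)%:C *: S).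
rewrite adjointZ conj_real -scalemxAr -scalemxAl scalerA -rmorphM/= -expr2.
by rewrite sqr_sqrtr// -ES.
Qed.

(** With [M = S S^*] the form is [|S^* v|^2], and [v] is recovered from [S^* v]
    by a bounded linear map. *)
Lemma psd_coercive n (M : 'M[C]_n) : psdmx M -> M \in unitmx ->
  exists2 m : R, 0 < m &
    forall v : 'cV[C]_n, m * rip v v <= rip v (M *m v).
Proof.
move=> /psd_gram [S ->]; rewrite unitmx_mul => /andP[_ uS].
have K0 := entry_bound_ge0 (invmx (S^t*)).
(* [+ 1] because the bound is zero in dimension [0] *)
exists (entry_bound (invmx (S^t*)) + 1)^-1 => [|v]; first by rewrite invr_gt0; lra.
rewrite -mulmxA rip_sym rip_mull ler_pdivrMl; last by lra.
have := rip_mulmx_bounded (invmx (S^t*)) (S^t* *m v); rewrite mulKmx//.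
have := rip_ge0 (S^t* *m v); rewrite mulrDl mul1r; lra.
Qed.

Lemma bounded_below_unit n (M : 'M[C]_n) :
  (forall v : 'cV[C]_n, rip v v <= rip v (M *m v)) -> M \in unitmx.
Proof.
move=> h; rewrite -unitmx_tr unitmxE unitfE; apply/negP => /det0P[v v0 vM].
have := h v^T; rewrite -[M]trmxK -trmx_mul vM trmx0 {2}/rip mulmx0 mxtrace0 => h0.
have /eqP rv0 : rip v^T v^T == 0 by rewrite eq_le h0 rip_ge0.
have /vnorm_eq0/(congr1 trmx) : vnorm v^T = 0 by rewrite vnormE rv0 sqrtr0.
by rewrite trmxK trmx0 => vz; rewrite vz eqxx in v0.
Qed.

(** The determinant is affine in each diagonal entry: expand along row [j]. *)
Lemma det_add_diag n (M : 'M[C]_n) (s : C) j :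
  \det (M + s *: delta_mx j j) = \det M + s * cofactor M j j.
Proof.
rewrite (expand_det_row _ j) (expand_det_row M j).
have cof k : cofactor (M + s *: delta_mx j j) j k = cofactor M j k.
  rewrite /cofactor; congr (_ * \det _); apply/matrixP => a b.
  by rewrite !mxE eq_sym (negbTE (neq_lift _ _)) mulr0 addr0.
under eq_bigr do rewrite cof !mxE eqxx mulrDl.
rewrite big_split/=; congr (_ + _); rewrite (bigD1 j)//= eqxx mulr1 big1 ?addr0//.
by move=> k kj; rewrite (negbTE kj) mulr0 mul0r.
Qed.

Lemma Re_det_add_diag n (M : 'M[C]_n) (s : R) j :
  Re (\det (M + s%:C *: delta_mx j j)) = Re (\det M) + s * Re (cofactor M j j).
Proof. by rewrite det_add_diag cReD cReZ. Qed.

Lemma invmx_diag n (M : 'M[C]_n) j : M \in unitmx ->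
  invmx M j j = cofactor M j j / \det M.
Proof. by move=> uM; rewrite /invmx uM !mxE mulrC. Qed.

Lemma Re_invmx_diag n (M : 'M[C]_n) j : psdmx M -> M \in unitmx ->
  Re (invmx M j j) = Re (cofactor M j j) / Re (\det M).
Proof.
move=> /psd_det; rewrite lecE => /andP[/eqP iM _] uM; rewrite invmx_diag//.
have -> : \det M = (Re (\det M))%:C by move: iM; case: (\det M) => a b /= ->.
by rewrite -fmorphV/= mulrC cReZ mulrC.
Qed.

(** * Perturbation and compactness of the feasible set *)

Lemma diagC_add_delta n (l : 'rV[R]_n) s j :
  diagC (l + s *: delta_mx 0 j) = diagC l + s%:C *: delta_mx j j.
Proof.
apply/matrixP => a b; rewrite !mxE eqxx/=.
case: (eqVneq a b) => [->|ab]; last first.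
  rewrite !mulr0n add0r; case: eqP => [ea|]; last by rewrite mulr0.
  by rewrite ea eq_sym in ab; rewrite (negbTE ab) mulr0.
by rewrite !mulr1n andbb rmorphD rmorphM/= rmorph_nat.
Qed.

Lemma sum_add_delta n (l : 'rV[R]_n) s j :
  \sum_i (l + s *: delta_mx 0 j) 0 i = \sum_i l 0 i + s.
Proof.
under eq_bigr do rewrite mxE; rewrite big_split/=; congr (_ + _).
rewrite (bigD1 j)//= big1 ?addr0 => [|i ij]; rewrite !mxE ?eqxx ?mulr1//=.
by rewrite (negbTE ij) mulr0.
Qed.

(** Positive definiteness is an open condition, so the maximum of the barrier is
    interior and its partial derivatives vanish. *)
Lemma feasible_perturb n (A : 'M[C]_n) (l : 'rV[R]_n) (a s : R) j :
  A \is hermsymmx ->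
  (forall v : 'cV[C]_n, a * rip v v <= rip v ((diagC l - A) *m v)) ->
  (forall v : 'cV[C]_n, a * rip v v <= rip v ((diagC l + A) *m v)) ->
  `|s| <= a -> feasible A (l + s *: delta_mx 0 j).
Proof.
move=> hA h1 h2 sa; apply/(feasibleP _ hA) => v.
have := h1 v; have := h2 v; rewrite mulmxBl mulmxDl !(ripDr, ripNr).
have -> : rip v (diagC (l + s *: delta_mx 0 j) *m v) =
    rip v (diagC l *m v) + s * normc (v j 0) ^+ 2.
  rewrite !rip_diagC -[normc _ ^+ 2]mul1r.
  rewrite (_ : s * _ =
      \sum_i (s *: delta_mx 0 j : 'rV_n) 0 i * normc (v i 0) ^+ 2).
    rewrite -big_split; apply: eq_bigr => i _ /=.
    by rewrite big_ord1 -normc_sqr mxE mulrDl.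
  rewrite (bigD1 j)//= big1 ?addr0 => [|i ij]; rewrite !mxE ?eqxx ?mulr1 ?mul1r//=.
  by rewrite (negbTE ij) mulr0 mul0r.
have vj : normc (v j 0) ^+ 2 <= rip v v.
  by rewrite -vnorm_sqr ler_pXn2r ?nnegrE ?normc_ge0 ?vnorm_ge0// coord_le_vnorm.
have : `|s * normc (v j 0) ^+ 2| <= a * rip v v.
  by rewrite normrM (ger0_norm (sqr_ge0 _)) ler_pM ?sqr_ge0.
by rewrite !ler_norml; lra.
Qed.

(** A large constant vector works. *)
Lemma strictly_feasible n (A : 'M[C]_n) : A \is hermsymmx ->
  exists l : 'rV[R]_n, [/\ feasible A l,
    diagC l - A \in unitmx & diagC l + A \in unitmx].
Proof.
move=> hA; pose c := entry_bound A + 2.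
have hD (v : 'cV[C]_n) : rip v (diagC (const_mx c) *m v) = c * rip v v.
  rewrite rip_diagC rip_cV mulr_sumr; apply: eq_bigr => i _.
  by rewrite big_ord1 -normc_sqr mxE.
have hAv (v : 'cV[C]_n) : `|rip v (A *m v)| <= (entry_bound A + 1) * rip v v.
  have := rip_ge0 (v - A *m v); have := rip_ge0 (v + A *m v).
  have := rip_mulmx_bounded A v; have := rip_ge0 v; have := rip_ge0 (A *m v).
  rewrite !(ripDl, ripDr, ripNl, ripNr) (rip_sym (A *m v) v).
  by rewrite ler_norml; lra.
exists (const_mx c); split.
- apply/(feasibleP _ hA) => v; apply: le_trans (hAv v) _.
  by rewrite hD ler_wpM2r ?rip_ge0// /c lerD2l; lra.
- apply: bounded_below_unit => v; rewrite mulmxBl ripDr ripNr hD.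
  by have := hAv v; rewrite ler_norml /c; lra.
- apply: bounded_below_unit => v; rewrite mulmxDl ripDr hD.
  by have := hAv v; rewrite ler_norml /c; lra.
Qed.

Lemma linear_continuous_rV n (c : 'I_n -> R) :
  continuous (fun l : 'rV[R]_n => \sum_j l 0 j * c j).
Proof.
apply: continuous_big => [|j _]; first exact: add_continuous.
move=> l; apply: continuousM; first exact: coord_continuous.
exact: cst_continuous.
Qed.

Lemma sum_continuous_rV n : continuous (fun l : 'rV[R]_n => \sum_j l 0 j).
Proof.
rewrite (_ : (fun l => _) = fun l : 'rV[R]_n => \sum_j l 0 j * 1).
  exact: linear_continuous_rV.
by apply/funext => l; apply: eq_bigr => j _; rewrite mulr1.
Qed.

Definition capped n (A : 'M[C]_n) (m : R) : set 'rV[R]_n :=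
  [set l | feasible A l /\ \sum_j l 0 j <= m].

(** The set lies in the cube [[0, m]^n], and each vector [v] contributes one
    closed condition that is linear in [l]. *)
Lemma capped_compact n (A : 'M[C]_n) m : A \is hermsymmx -> compact (capped A m).
Proof.
move=> hA.
apply: (@subclosed_compact _ _
  [set l : 'rV[R]_n | forall i, `[0, m]%classic (l ord0 i)]).
- rewrite (_ : capped A m =
    \bigcap_(v in [set: 'cV[C]_n])
      ((fun l : 'rV[R]_n => \sum_j l 0 j * Re ((v j 0)^* * v j 0)) @^-1`
         [set x | `|rip v (A *m v)| <= x]) `&`
    ((fun l : 'rV[R]_n => \sum_j l 0 j * 1) @^-1` [set x | x <= m])).
    have lc c := (continuous_closedP _).1 (@linear_continuous_rV n c).
    apply: closedI; last by apply: (lc (fun=> 1)); exact: closed_le.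
    apply: closed_bigI => v _; apply: (lc (fun j => Re ((v j 0)^* * v j 0))).
    exact: closed_ge.
  apply/seteqP; split=> l /=.
    move=> [/(feasibleP _ hA) fl lm]; split.
      move=> v _; apply: le_trans (fl v) _; rewrite rip_diagC.
      by apply: ler_sum => i _; rewrite big_ord1.
    by under eq_bigr do rewrite mulr1.
  move=> [fl]; under eq_bigr do rewrite mulr1.
  move=> lm; split=> //; apply/(feasibleP _ hA) => v.
  apply: le_trans (fl v I) _; rewrite rip_diagC.
  by apply: ler_sum => i _; rewrite big_ord1.
- apply: (@rV_compact R n (fun=> `[0, m]%classic)) => i.
  exact: segment_compact.
- move=> l [[l0 _ _] lm] i /=; rewrite in_itv/= l0/=.
  apply: le_trans lm; rewrite (bigD1 i)//= lerDl.
  by apply: sumr_ge0.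
Qed.

(** * The barrier function and its maximum *)

(** Only the real part of a determinant occurs in the barrier, but continuity of
    both parts is what passes through products. *)
Definition complex_continuous (T : topologicalType) (f : T -> C) : Prop :=
  continuous (fun x => Re (f x)) /\ continuous (fun x => Im (f x)).

Lemma complex_continuous_cst (T : topologicalType) (c : C) :
  complex_continuous (fun _ : T => c).
Proof. by split=> x; exact: cst_continuous. Qed.

Lemma complex_continuousD (T : topologicalType) (f g : T -> C) :
  complex_continuous f -> complex_continuous g ->
  complex_continuous (fun x => f x + g x).
Proof.
have ImD z w : Im (z + w) = Im z + Im w :> R by case: z w => ? ? [].
move=> [f1 f2] [g1 g2]; split=> x.
  by under eq_fun do rewrite cReD; apply: cvgD; [exact: f1|exact: g1].
by under eq_fun do rewrite ImD; apply: cvgD; [exact: f2|exact: g2].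
Qed.

Lemma complex_continuousM (T : topologicalType) (f g : T -> C) :
  complex_continuous f -> complex_continuous g ->
  complex_continuous (fun x => f x * g x).
Proof.
have ImM z w : Im (z * w) = Re z * Im w + Im z * Re w :> R by case: z w => ? ? [].
move=> [f1 f2] [g1 g2]; split=> x.
  under eq_fun do rewrite cReM; apply: cvgB; apply: cvgM;
    by [exact: f1|exact: f2|exact: g1|exact: g2].
under eq_fun do rewrite ImM; apply: cvgD; apply: cvgM;
  by [exact: f1|exact: f2|exact: g1|exact: g2].
Qed.

Lemma complex_continuous_big (T : topologicalType) (op : C -> C -> C) (c : C) I
    (r : seq I) (F : I -> T -> C) :
  (forall f g, complex_continuous f -> complex_continuous g ->
    complex_continuous (fun x : T => op (f x) (g x))) ->
  (forall i, complex_continuous (F i)) ->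
  complex_continuous (fun x => \big[op/c]_(i <- r) F i x).
Proof.
move=> hop hF; elim: r => [|i r IH].
  by under eq_fun do rewrite big_nil; exact: complex_continuous_cst.
under eq_fun do rewrite big_cons.
by apply: hop.
Qed.

Lemma complex_continuous_det (T : topologicalType) n (F : T -> 'M[C]_n) :
  (forall i j, complex_continuous (fun x => F x i j)) ->
  complex_continuous (fun x => \det (F x)).
Proof.
move=> hF; rewrite /determinant; apply: complex_continuous_big => [|s].
  by move=> f g; exact: complex_continuousD.
apply: complex_continuousM; first exact: complex_continuous_cst.
by apply: complex_continuous_big => // f g; exact: complex_continuousM.
Qed.

Lemma complex_continuous_diagC n (A : 'M[C]_n) i j :
  complex_continuous (fun l : 'rV[R]_n => (diagC l + A) i j).
Proof.
under eq_fun do rewrite mxE.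
apply: complex_continuousD; last exact: complex_continuous_cst.
case: (eqVneq i j) => [->|ij].
  under eq_fun do rewrite !mxE eqxx mulr1n.
  by split; [exact: coord_continuous|move=> x; exact: cst_continuous].
under eq_fun do rewrite !mxE (negbTE ij) mulr0n.
exact: complex_continuous_cst.
Qed.

(** Its logarithm is the sum of the logarithmic barriers of the three constraints
    that define [capped], the one on the trace having weight [k + 1].  Being a
    polynomial, it is also continuous at the boundary, where it vanishes. *)
Definition barrier n (A : 'M[C]_n) (m : R) (k : nat) (l : 'rV[R]_n) : R :=
  (m - \sum_j l 0 j) ^+ k.+1 * Re (\det (diagC l - A)) * Re (\det (diagC l + A)).

Lemma barrier_continuous n (A : 'M[C]_n) m k : continuous (barrier A m k).
Proof.
have detc B : continuous (fun l : 'rV[R]_n => Re (\det (diagC l + B))).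
  apply: (complex_continuous_det _).1 => i j.
  exact: complex_continuous_diagC.
have powc : continuous (fun x : R => x ^+ k.+1).
  rewrite (_ : (fun x => _) = horner ('X ^+ k.+1)); first exact: continuous_horner.
  by apply/funext => x; rewrite hornerXn.
move=> l.
apply: (@continuousM R _ (fun l : 'rV[R]_n => _ * _) (fun l : 'rV[R]_n => _));
  last exact: detc.
apply: (@continuousM R _ (fun l : 'rV[R]_n => _) (fun l : 'rV[R]_n => _));
  last exact: detc.
apply: (@continuous_comp _ _ _ (fun l : 'rV[R]_n => m - \sum_j l 0 j)
  (fun x => x ^+ k.+1)); last exact: powc.
by apply: continuousB; [exact: cst_continuous|exact: sum_continuous_rV].
Qed.

Lemma poly_local_max (p : {poly R}) (d : R) : 0 < d ->
  (forall s, `|s| < d -> p.[s] <= p.[0]) -> p^`().[0] = 0.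
Proof.
move=> d0 h; rewrite derivE derive1E; apply: derive_val.
apply: (@derive1_at_max _ (horner p) (- d) d 0) => [|t _||t].
- by rewrite ge0_cp ?ltW.
- exact: derivable_horner.
- by rewrite in_itv/= oppr_lt0 d0.
- by rewrite in_itv/= -ltr_norml; exact: h.
Qed.

(** Logarithmic derivative at [0] of the function of [s], which has a local
    maximum there. *)
Lemma barrier_stationary (k : nat) (t D1 D2 C1 C2 d : R) :
  0 < t -> 0 < D1 -> 0 < D2 -> 0 < d ->
  (forall s, `|s| < d ->
    (t - s) ^+ k.+1 * (D1 + s * C1) * (D2 + s * C2) <= t ^+ k.+1 * D1 * D2) ->
  C1 / D1 + C2 / D2 = k.+1%:R / t.
Proof.
move=> t0 D10 D20 d0 h.
pose p : {poly R} := (t%:P - 'X) ^+ k.+1 * (D1%:P + C1 *: 'X) * (D2%:P + C2 *: 'X).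
have pE s : p.[s] = (t - s) ^+ k.+1 * (D1 + s * C1) * (D2 + s * C2).
  by rewrite /p !(hornerE, horner_exp) ![_ * s]mulrC.
have : p^`().[0] = 0.
  apply: (poly_local_max d0) => s sd.
  by rewrite !pE subr0 !mul0r !addr0; exact: h.
rewrite /p !derivM deriv_exp !poly.derivE /= !(hornerE, horner_exp, hornerMn) /=.
rewrite !(mul0r, mulr0, addr0, subr0, add0r) exprS => hd.
have tk : t ^+ k != 0 by rewrite expf_neq0 ?gt_eqF.
have : t ^+ k * (t * (C1 * D2 + C2 * D1) - k.+1%:R * (D1 * D2)) = 0.
  rewrite -{}hd -[_ *+ k.+1]mulr_natr; ring.
move/eqP; rewrite mulf_eq0 (negbTE tk)/= subr_eq0 => /eqP hh.
have D1n : D1 != 0 by rewrite gt_eqF.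
have D2n : D2 != 0 by rewrite gt_eqF.
rewrite addf_div//; apply/eqP; rewrite eqr_div ?mulf_neq0 ?(gt_eqF t0)//.
by rewrite mulrC hh.
Qed.

(** The gap of the dual point built at the maximum is
    [2 n (m - \tr D) / (k+1)], since [(D - A) (D - A)^-1] and
    [(D + A) (D + A)^-1] each have trace [n]. *)
Lemma barrier_certificate n (A : 'M[C]_n) : A \is hermsymmx ->
  exists2 B : R, 0 <= B & forall k, exists l S T,
    [/\ feasible A l, unit_diag S T & slack A l S T <= B / k.+1%:R].
Proof.
move=> hA; have [l0 [f0 u01 u02]] := strictly_feasible hA.
have [p01 p02] := feasible_psd f0.
(* chosen so that the barrier is positive at [l0] *)
pose m := \sum_j l0 0 j + 1.
have m0 : 0 <= m by rewrite addr_ge0// sumr_ge0// => j _; have [] := f0.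
exists (2 * n%:R * m) => [|k]; first by rewrite !mulr_ge0.
have [|l] := @EVT_max_rV R n (barrier A m k) (capped A m) _
    (@capped_compact n A m hA)
    (continuous_subspaceT (@barrier_continuous n A m k)).
  by exists l0; split=> //; rewrite /m lerDl.
rewrite inE => -[fl lm] maxl.
have [p1 p2] := feasible_psd fl.
pose t := m - \sum_j l 0 j.
have t0 : 0 <= t by rewrite subr_ge0.
have [D10 D20] : 0 <= Re (\det (diagC l - A)) /\ 0 <= Re (\det (diagC l + A)).
  by split; [have := psd_det p1|have := psd_det p2]; rewrite lecE => /andP[].
have : 0 < barrier A m k l.
  apply: (@lt_le_trans _ _ (barrier A m k l0)).
    rewrite /barrier /m [_ + 1 - _]addrAC subrr add0r expr1n mul1r.
    by rewrite mulr_gt0// psd_det_gt0.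
  by apply: maxl; rewrite inE; split=> //; rewrite /m lerDl.
rewrite /barrier -/t => g0.
have tp : 0 < t.
  by rewrite lt_def t0 andbT; apply: contraTneq g0 => ->; rewrite expr0n !mul0r ltxx.
have D1p : 0 < Re (\det (diagC l - A)).
  by rewrite lt_def D10 andbT; apply: contraTneq g0 => ->; rewrite mulr0 mul0r ltxx.
have D2p : 0 < Re (\det (diagC l + A)).
  by rewrite lt_def D20 andbT; apply: contraTneq g0 => ->; rewrite mulr0 ltxx.
have unitP (M : 'M[C]_n) : 0 < Re (\det M) -> M \in unitmx.
  by rewrite unitmxE unitfE => h; apply: contraTneq h => ->; rewrite ltxx.
have u1 := unitP _ D1p; have u2 := unitP _ D2p.
have [a1 a10 co1] := psd_coercive p1 u1; have [a2 a20 co2] := psd_coercive p2 u2.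
pose d := Num.min t (Num.min a1 a2).
have d0 : 0 < d by rewrite !lt_min tp a10.
have stat j : Re (cofactor (diagC l - A) j j) / Re (\det (diagC l - A)) +
    Re (cofactor (diagC l + A) j j) / Re (\det (diagC l + A)) = k.+1%:R / t.
  apply: (@barrier_stationary k t _ _ _ _ d) => // s sd.
  move: (sd); rewrite !lt_min => /and3P[st s1 s2].
  have inK : capped A m (l + s *: delta_mx 0 j).
    split; last by rewrite sum_add_delta; move: st; rewrite ltr_norml /t; lra.
    apply: (@feasible_perturb _ _ _ (Num.min a1 a2) _ _ hA) => [v|v|].
    - by apply: le_trans (co1 v); rewrite ler_wpM2r ?rip_ge0// ge_min lexx.
    - by apply: le_trans (co2 v); rewrite ler_wpM2r ?rip_ge0// ge_min lexx orbT.
    - by rewrite le_min !ltW.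
  have := maxl _ (mem_set inK); rewrite /barrier sum_add_delta diagC_add_delta.
  rewrite (addrAC (diagC l) _ (- A)) (addrAC (diagC l) _ A) !Re_det_add_diag.
  by rewrite opprD addrA.
(* by [stat], this is the scaling of the inverses that makes the diagonal [1] *)
have mu0 : 0 <= t / k.+1%:R by rewrite divr_ge0.
have [S ES] := inv_gram p1 u1 mu0; have [T ET] := inv_gram p2 u2 mu0.
exists l, S, T; split=> // [j|].
  rewrite ES ET -scalerDr mxE cReZ mxE cReD !Re_invmx_diag// stat.
  by rewrite mulrA divfK ?divff ?gt_eqF.
rewrite /slack !rip_tr ES ET -!scalemxAr !mulmxV// mxtraceZ mxtrace1.
rewrite cReZ (_ : Re n%:R = n%:R); last by rewrite -(rmorph_nat (real_complex R)).
rewrite (_ : _ + _ = 2 * n%:R * t / k.+1%:R); last first.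
  by move: (k.+1%:R^-1) => z; ring.
rewrite ler_pM2r ?invr_gt0// ler_wpM2l ?mulr_ge0// /t lerBlDr lerDl.
by rewrite sumr_ge0// => j _; have [] := fl.
Qed.

Lemma near_optimal_certificate n (A : 'M[C]_n) (e : R) : A \is hermsymmx ->
  0 < e -> exists l S T,
    [/\ feasible A l, unit_diag S T & slack A l S T <= e].
Proof.
move=> hA e0; have [B B0 hB] := barrier_certificate hA.
have [k kB] : exists k : nat, B / e < k%:R.
  by exists (Num.trunc (B / e)).+1; exact: truncnS_gt.
have [l [S [T [fl uST sl]]]] := hB k; exists l, S, T; split=> //.
apply: le_trans sl _; rewrite ler_pdivrMr// mulrC -ler_pdivrMr//.
by apply: le_trans (ltW kB) _; rewrite ler_nat.
Qed.

(** * The Schur dual norm as the optimal value *)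

Lemma schur_dual_norm_has_ubound n (A : 'M[C]_n) : A \is hermsymmx ->
  has_ubound [set normc (\tr (Y^t* *m A))
    | Y in [set Y : 'M[C]_n | schur_norm Y <= 1]].
Proof.
move=> hA; have [l [fl _ _]] := strictly_feasible hA.
by exists (\sum_j l 0 j) => _ [Y Y1 <-]; exact: weak_duality.
Qed.

Lemma schur_dual_norm_le n (A : 'M[C]_n) l : A \is hermsymmx -> feasible A l ->
  schur_dual_norm A <= \sum_j l 0 j.
Proof.
move=> hA fl; apply: ge_sup; last by move=> _ [Y Y1 <-]; exact: weak_duality.
exists (normc (\tr ((0 : 'M[C]_n)^t* *m A))); exists 0 => //=.
apply/schur_norm_le1P => X _ u v; rewrite (_ : schur_prod 0 X = 0).
  exact: contraction0.
by apply/matrixP => i j; rewrite !mxE mul0r.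
Qed.

Lemma schur_dual_norm_ge n (A S T : 'M[C]_n) (l : 'rV[R]_n) : A \is hermsymmx ->
  unit_diag S T -> \sum_j l 0 j - slack A l S T <= schur_dual_norm A.
Proof.
move=> hA uST; rewrite slackE// opprB addrC subrK.
apply: le_trans (Re_le_normc _) _.
have -> : S *m S^t* - T *m T^t* = (S *m S^t* - T *m T^t*)^t*.
  by rewrite adjointD adjointN !adjointM !adjointK.
apply: ub_le_sup; first exact: schur_dual_norm_has_ubound.
by exists (S *m S^t* - T *m T^t*) => //; exact: schur_norm_certificate.
Qed.

(** A minimiser exists by compactness; comparing it with almost optimal dual
    points identifies the minimum. *)
Lemma optimal_exists n (A : 'M[C]_n) : A \is hermsymmx ->
  exists2 l : 'rV[R]_n, feasible A l & \sum_j l 0 j = schur_dual_norm A.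
Proof.
move=> hA; have [l0 [f0 _ _]] := strictly_feasible hA.
have [|l] := @EVT_min_rV R n (fun l => \sum_j l 0 j) (capped A (\sum_j l0 0 j)) _
  (@capped_compact n A _ hA) (continuous_subspaceT (@sum_continuous_rV n)).
  by exists l0; split.
rewrite inE => -[fl ll0] minl; exists l => //.
apply/eqP; rewrite eq_le schur_dual_norm_le// andbT.
apply/ler_addgt0Pr => e e0.
have [l1 [S [T [f1 uST sl]]]] := near_optimal_certificate hA e0.
(* [l1] may exceed the cap, but then it exceeds the minimum as well *)
have ll1 : \sum_j l 0 j <= \sum_j l1 0 j.
  have [c|c] := lerP (\sum_j l1 0 j) (\sum_j l0 0 j).
    by apply: minl; rewrite inE; split.
  exact: le_trans ll0 (ltW c).
have := @schur_dual_norm_ge _ A S T l1 hA uST; lra.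
Qed.

(** A dual point with small gap at one feasible vector has at most the same gap
    at every optimal one, so the two optimal vectors are both close to the
    diagonal it determines. *)
Lemma optimal_unique n (A : 'M[C]_n) (l l' : 'rV[R]_n) : A \is hermsymmx ->
  feasible A l -> feasible A l' -> \sum_j l 0 j = schur_dual_norm A ->
  \sum_j l' 0 j = schur_dual_norm A -> l = l'.
Proof.
move=> hA fl fl' sl sl'; apply/rowP => j.
have l0 : 0 <= l 0 j by have [] := fl.
have l'0 : 0 <= l' 0 j by have [] := fl'.
have close e : 0 < e -> `|l 0 j - l' 0 j| <= e * (l 0 j + l' 0 j + 2).
  move=> e0; have e20 : 0 < e ^+ 2 by rewrite exprn_gt0.
  have [l1 [S [T [f1 uST s1]]]] := near_optimal_certificate hA e20.
  have slackl (k : 'rV[R]_n) :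
      \sum_j k 0 j = schur_dual_norm A -> slack A k S T <= e ^+ 2.
    have := schur_dual_norm_le hA f1; move: s1; rewrite !slackE// => h1 h2 ->.
    by move: h1 h2; set x := Re _; lra.
  have := slack_complementarity j fl uST e0 (slackl _ sl).
  have := slack_complementarity j fl' uST e0 (slackl _ sl').
  move: (Re _) => x; rewrite !ler_norml; lra.
apply/eqP; rewrite -subr_eq0 -normr_le0; apply/ler_addgt0Pr => e e0.
pose c := l 0 j + l' 0 j + 2.
have c0 : 0 < c by rewrite /c; lra.
by have := close (e / c) (divr_gt0 e0 c0); rewrite -/c divfK ?gt_eqF// add0r.
Qed.

End SchurDual.

Theorem corollary4p2 (R : realType) (n : nat) (A : 'M[R[i]]_n)
    (hA : A \is hermsymmx) :
  schur_dual_norm A =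
    inf [set t : R | exists2 lambda : 'rV[R]_n,
                       feasible A lambda & \tr (diagC lambda) = t%:C] /\
  (A != 0 ->
   exists! lambda : 'rV[R]_n,
     feasible A lambda /\ \tr (diagC lambda) = (schur_dual_norm A)%:C).
Proof.
have [l fl sl] := optimal_exists hA.
split=> [|_].
  apply/eqP; rewrite eq_le; apply/andP; split.
    apply: lb_le_inf; first by exists (schur_dual_norm A), l; rewrite ?tr_diagC ?sl.
    by move=> t [k fk]; rewrite tr_diagC => -[<-]; exact: schur_dual_norm_le.
  apply: ge_inf; last by exists l; rewrite ?tr_diagC ?sl.
  exists (schur_dual_norm A) => t [k fk].
  by rewrite tr_diagC => -[<-]; exact: schur_dual_norm_le.
exists l; split; first by rewrite tr_diagC sl.
move=> k [fk]; rewrite tr_diagC => -[sk]; exact: optimal_unique fl fk sl sk.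
Qed.
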